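(* If $X$ is a $T_1$ space such that the Alexandroff duplicate $AD(X)$ is star-$K$-Scheepers, then $e(X)\leq\omega$.
   Context: The Alexandroff duplicate of $X$ is $AD(X)=X\times\{0,1\}$ topologized as follows: each point of $X\times\{1\}$ is isolated, and a basic neighbourhood of $(x,0)\in X\times\{0\}$ is a set of the form $(U\times\{0\})\cup((U\times\{1\})\setminus\{(x,1)\})$, where $U$ is a neighbourhood of $x$ in $X$. For a subset $A$ of a space $Z$ and a collection $\mathcal{P}$ of subsets of $Z$, $St(A,\mathcal{P})=\bigcup\{B\in\mathcal{P}: A\cap B\neq\emptyset\}$. An open cover $\mathcal{U}$ of $Z$ is an $\omega$-cover if each finite $F\subseteq Z$ is contained in some $U\in\mathcal{U}$ (the set $Z$ itself is allowed to be a member). $Z$ is star-$K$-Scheepers if for each sequence $(\mathcal{U}_n)_{n\in\mathbb{N}}$ of open covers of $Z$ there is a sequence $(K_n)_{n\in\mathbb{N}}$ of compact subsets of $Z$ such that $\{St(K_n,\mathcal{U}_n): n\in\mathbb{N}\}$ is an $\omega$-cover of $Z$. The extent of $X$ is $e(X)=\sup\{|Y|: Y \text{ is a closed and discrete subspace of } X\}$. *)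

(* Defs.v *)
From HB Require Import structures.
From mathcomp Require Import all_boot all_order all_algebra.
From mathcomp Require Import all_classical topology.
Set Implicit Arguments.
Unset Strict Implicit.
Unset Printing Implicit Defensive.
Local Open Scope classical_set_scope.

(* An alias of X * bool, so that it does not inherit the product topology;
   false stands for 0 and true for 1. *)
Definition alexandroff_duplicate (X : Type) : Type := (X * bool)%type.

Section AlexandroffDuplicate.
Context {X : topologicalType}.
Local Notation AD := (alexandroff_duplicate X).

HB.instance Definition _ := Choice.copy AD (X * bool)%type.

Definition ad_basic (x : X) (U : set X) : set AD :=
  (U `*` [set false]) `|` ((U `*` [set true]) `\ (x, true)).

(* The topology whose basic neighbourhoods are the sets ad_basic x U and the
   singletons [set (x, true)].  When X is T1 they are neighbourhoods, and the
   neighbourhood filters are the ones they generate: see ad_nbhs0, ad_nbhs1.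
   Without T1, ad_basic x U may fail to be a neighbourhood of (x, false). *)
Definition ad_open : set_system AD :=
  [set O | forall x : X, O (x, false) ->
     exists2 U, nbhs x U & ad_basic x U `<=` O].

Let ad_openT : ad_open setT.
Proof. by move=> x _; exists setT => //; exact: filterT. Qed.

Let ad_openI : setI_closed ad_open.
Proof.
move=> A B oA oB x [/oA[U xU UA] /oB[V xV VB]].
exists (U `&` V); first exact: filterI.
move=> q [[[Uq Vq] q2]|[[[Uq Vq] q2] qx]].
  by split; [apply: UA|apply: VB]; left.
by split; [apply: UA|apply: VB]; right.
Qed.

Let ad_open_bigU (I : Type) (f : I -> set AD) :
  (forall i, ad_open (f i)) -> ad_open (\bigcup_i f i).
Proof.
move=> of_ x [i _ /of_ [U xU UA]]; exists U => //.
by move=> q /UA ?; exists i.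
Qed.

HB.instance Definition _ :=
  isOpenTopological.Build AD ad_openT ad_openI ad_open_bigU.

Lemma ad_openE (A : set AD) : open A = ad_open A.
Proof. by []. Qed.

Lemma ad_nbhs1 (x : X) (A : set AD) : nbhs ((x, true) : AD) A <-> A (x, true).
Proof.
split; first exact: nbhs_singleton.
move=> Ax; rewrite nbhsE; exists [set (x, true)]; last by move=> _ ->.
by split => //; rewrite ad_openE => y.
Qed.

Lemma ad_nbhs0 (x : X) (A : set AD) : accessible_space X ->
  nbhs ((x, false) : AD) A <-> exists2 U, nbhs x U & ad_basic x U `<=` A.
Proof.
move=> T1; split.
  move=> xA.
  have [O [oO Ox] OA] : exists2 O, open_nbhs ((x, false) : AD) O & O `<=` A.
    by move: xA; rewrite nbhsE.
  have [U xU UO] : exists2 U, nbhs x U & ad_basic x U `<=` O by exact: oO.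
  by exists U => // q /UO /OA.
move=> [U]; rewrite nbhsE => -[V [oV Vx] VU] UA.
rewrite nbhsE; exists (ad_basic x V).
  split; last by left.
  rewrite ad_openE => y [[/= Vy _]|[[_ //]]].
  have [<-|/eqP yx] := pselect (x = y).
    by exists V => //; exact: open_nbhs_nbhs.
  have [W [oW yW xW]] := T1 y x (contra_neq (@esym _ _ _) yx).
  exists (V `&` W).
    by apply: filterI; apply: open_nbhs_nbhs; split => //; exact/set_mem.
  move=> [z b] [[[/= Vz Wz] ->]|[[[/= Vz Wz] ->] zy]]; first by left.
  right; split => // -[zx]; move: xW; rewrite inE; apply.
  by rewrite -zx.
move=> q [[/= Vq q2]|[[/= Vq q2] qx]]; apply: UA; [left|right] => //.
  by split => //; exact: VU.
by split => //; split => //; exact: VU.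
Qed.

End AlexandroffDuplicate.

Definition star (T : Type) (A : set T) (P : set (set T)) : set T :=
  \bigcup_(B in [set B | P B /\ A `&` B !=set0]) B.

Definition open_cover (Z : topologicalType) (U : set (set Z)) : Prop :=
  U `<=` open /\ \bigcup_(B in U) B = setT.

Definition omega_cover (Z : topologicalType) (U : set (set Z)) : Prop :=
  open_cover U /\
  forall F : set Z, finite_set F -> exists2 B, U B & F `<=` B.

Definition star_K_Scheepers (Z : topologicalType) : Prop :=
  forall U : nat -> set (set Z), (forall n, open_cover (U n)) ->
  exists2 K : nat -> set Z, (forall n, compact (K n)) &
    omega_cover [set star (K n) (U n) | n in [set: nat]].

(* Y, as a type, carries the subspace topology. *)
Definition discrete_subspace (X : topologicalType) (Y : set X) : Prop :=
  forall y : Y, open [set y].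

(* e(X) <= |K|: since e(X) is a supremum of cardinals, this says that |K| is an
   upper bound of the cardinals |Y|. *)
Definition extent_le (X : topologicalType) (K : Type) : Prop :=
  forall Y : set X, closed Y -> discrete_subspace Y -> (Y #<= [set: K])%card.

(* Main.v *)
Require Import Defs.
From mathcomp Require Import all_boot all_order all_algebra.
From mathcomp Require Import all_classical topology.

(** Let Y be closed and discrete in X.  Then D = Y * {1} is closed in AD(X) and
    its points are isolated, so each compact set meets D in a finite set.  Let U
    be the open cover of AD(X) by the complement of D and the singletons of D:
    then star K U meets D only in points of K.  If countably many such stars
    with K compact cover AD(X), then D is a countable union of finite sets. *)

Local Open Scope classical_set_scope.

(** If [K] were infinite, the sets containing all but finitely many points of [K] would form a
    proper filter. It cannot cluster at a point [p] of [K]: the complement of [p] belongs to it, and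
    [[set p]] is a neighbourhood of [p]. *)
Lemma compact_isolated_finite {T : topologicalType} {K : set T} :
  compact K -> (forall x, K x -> open [set x]) -> finite_set K.
Proof.
move=> cK oK; apply: contrapT => infK.
pose F : set_system T := [set A | finite_set (K `\` A)].
have FF : ProperFilter F.
  split; first by rewrite /F /= setD0.
  split; first by rewrite /F /= setDT.
    by move=> A B FA FB; rewrite /F /= setDIr finite_setU.
  move=> A B AB; apply: sub_finite_set => x [Kx nBx].
  by split=> // /AB.
have FK : F K by rewrite /F /= setDv.
have [p [Kp clp]] := cK F FF FK.
have Fp : F (~` [set p]).
  by apply: (sub_finite_set _ (finite_set1 p)) => x [_] /contrapT.
have np : nbhs p [set p] by apply: open_nbhs_nbhs; split=> //; exact: oK.
by have [q [qp /qp]] := clp _ _ Fp np.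
Qed.

Lemma discrete_subspace_nbhs {X : topologicalType} {Y : set X} {y : X} :
  discrete_subspace Y -> Y y -> exists2 U, nbhs y U & U `&` Y `<=` [set y].
Proof.
move=> dY Yy.
(* Openness in the subspace unfolds to an open [U] of [X] whose trace on [Y] is the singleton. *)
have [U oU Uy] := dY (exist _ y (mem_set Yy)).
exists U.
  apply: open_nbhs_nbhs; split=> //.
  suff : (set_val @^-1` U) (exist _ y (mem_set Yy)) by [].
  by rewrite Uy.
move=> z [Uz Yz].
have : (set_val @^-1` U) (exist _ z (mem_set Yz)) by [].
by rewrite Uy => /(congr1 val).
Qed.

Lemma ad_open1 (X : topologicalType) (x : X) :
  open ([set (x, true)] : set (alexandroff_duplicate X)).
Proof. by rewrite ad_openE => y. Qed.

(** Only the points [(x, false)] need a basic neighbourhood missing [Y * {1}]. If [x] is in [Y],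
    take [U] meeting [Y] in [x] alone: [ad_basic x U] leaves out [(x, true)], the one point that
    could be hit. Otherwise take the complement of [Y]. *)
Lemma ad_closed_discrete {X : topologicalType} {Y : set X} :
  closed Y -> discrete_subspace Y ->
  closed (Y `*` [set true] : set (alexandroff_duplicate X)).
Proof.
move=> cY dY; rewrite -openC ad_openE => x _.
have [Yx|nYx] := pselect (Y x).
  have [U xU UY] := discrete_subspace_nbhs dY Yx.
  exists U => // -[z b] [[_ /= ->] [_ //]|[[/= Uz ->] zx] [/= Yz _]].
  by apply: zx; rewrite (UY z).
exists (~` Y); first by apply: open_nbhs_nbhs; split=> //; exact: closed_openC.
by move=> [z b] [[/= nYz _]|[[/= nYz _] _]] [].
Qed.

Theorem corollary4p10 (X : topologicalType) :
  accessible_space X ->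
  star_K_Scheepers (alexandroff_duplicate X) ->
  extent_le X nat.
Proof.
move=> _ sX Y cY dY.
pose D : set (alexandroff_duplicate X) := Y `*` [set true].
have cD : closed D by exact: ad_closed_discrete.
pose U : set (set (alexandroff_duplicate X)) :=
  (~` D) |` [set [set p] | p in D].
have ocU : open_cover U.
  split=> [_ [->|[[y b] [/= _ ->] <-]]|].
  - exact: closed_openC.
  - exact: ad_open1.
  apply/seteqP; split=> // p _; have [Dp|nDp] := pselect (D p).
    by exists [set p] => //; right; exists p.
  by exists (~` D) => //; left.
have [K cK [[_ cover] _]] := sX (fun=> U) (fun=> ocU).
have finKD n : finite_set (K n `&` D).
  apply: compact_isolated_finite; first exact: compact_closedI.
  by move=> [y b] [_ [/= _ ->]]; exact: ad_open1.
have YK : Y `<=` \bigcup_n (fst @` (K n `&` D)).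
  move=> y Yy; have Dy : D (y, true) by [].
  have : [set: alexandroff_duplicate X] (y, true) by [].
  (* A member [B] of [U] containing [(y, true)] cannot be the complement of [D], so it is a
     singleton; as it meets [K n] in [q], this forces [q = (y, true)]. *)
  rewrite -cover => -[_ [n _ <-] [B [[->|[p Dp <-]] [q [Kq Bq]]] By]] //.
  by exists n => //; exists (y, true) => //; split=> //; rewrite By -Bq.
apply: (sub_countable (subset_card_le YK)).
by apply: bigcup_countable => // n _; exact/finite_set_countable/finite_image.
Qed.
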